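(* Let $\delta_1,\delta_2,\dots$ be, in this order, the relative rounding errors of a sequence of elementary floating-point operations performed with SR-nearness, in arithmetic with $u=\beta^{1-p}$. For a finite set $K$ of indices put $\psi_K=\prod_{k\in K}(1+\delta_k)$, and for an integer $m\ge 0$ put $\gamma_m(u^2)=(1+u^2)^m-1$. Let $K\subset\mathbb{N}$ be a finite set of indices of cardinality $n$. Then: 1. $E(\psi_K)=1$. 2. If $K'\subset\mathbb{N}$ is a finite set of indices with $|K\cap K'|=m$ such that $j<k$ for all $j\in K\triangle K'$ and all $k\in K\cap K'$, then $0\le \mathrm{Cov}(\psi_K,\psi_{K'})\le\gamma_m(u^2)$. 3. $V(\psi_K)\le\gamma_n(u^2)$.
   Context: Floating-point numbers: fix a base $\beta\ge2$ and precision $p\ge1$ (integers); $\mathcal F$ is the set of normal floating-point numbers $\pm m\beta^{e-p}$ with $m,e$ integers and $\beta^{p-1}\le m<\beta^p$ (underflow and overflow are ignored, so $e$ ranges over all integers). Put $u=\beta^{1-p}$. For real $x\ne0$, $\lceil x\rceil=\min\{y\in\mathcal F:y\ge x\}$, $\lfloor x\rfloor=\max\{y\in\mathcal F:y\le x\}$, and, for $x\notin\mathcal F$, $\theta(x)=(x-\lfloor x\rfloor)/(\lceil x\rceil-\lfloor x\rfloor)$. SR-nearness (stochastic rounding): for $x\notin\mathcal F\cup\{0\}$, $\mathrm{fl}(x)=\lceil x\rceil$ with probability $\theta(x)$ and $\mathrm{fl}(x)=\lfloor x\rfloor$ with probability $1-\theta(x)$; if $x\in\mathcal F\cup\{0\}$,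 $\mathrm{fl}(x)=x$. In a sequence of elementary operations $c_k\leftarrow a_k\,\mathrm{op}_k\,b_k$, $\mathrm{op}_k\in\{+,-,*,/\}$, whose operands are data or previously computed values, each rounding is made with these probabilities conditionally on all previous roundings. The relative error $\delta_k$ of the $k$th operation is defined by $\widehat c_k=\mathrm{fl}(\widehat a_k\,\mathrm{op}_k\,\widehat b_k)=(\widehat a_k\,\mathrm{op}_k\,\widehat b_k)(1+\delta_k)$, with $\delta_k=0$ when the exact result is $0$. It is known that $|\delta_k|\le u$ and $\mathbb{E}[\delta_k\mid\delta_1,\dots,\delta_{k-1}]=\mathbb{E}(\delta_k)=0$ for all $k$ (mean independence). $E$, $V$, $\mathrm{Cov}$ denote expectation, variance and covariance; $K\triangle K'=(K\cup K')\setminus(K\cap K')$. *)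

(* Defs.v *)
From HB Require Import structures.
From mathcomp Require Import all_boot all_order all_algebra.
From mathcomp Require Export finmap.
From mathcomp Require Export all_classical all_reals all_analysis.

Set Implicit Arguments.
Unset Strict Implicit.
Unset Printing Implicit Defensive.

Import Order.TTheory GRing.Theory Num.Theory.
Local Open Scope classical_set_scope.
Local Open Scope ring_scope.

Definition float (R : realType) (beta p : nat) : set R :=
  [set x | exists (s : bool) (m : nat) (e : int),
    [/\ (beta ^ p.-1 <= m)%N, (m < beta ^ p)%N
      & x = (-1) ^+ s * m%:R * beta%:R ^ (e - p%:Z)]].

Definition unit_roundoff (R : realType) (beta p : nat) : R :=
  beta%:R ^ (1 - p%:Z).

(* The minimum and the maximum are attained when x != 0; for x = 0 they do not
   exist (floats accumulate at 0) and the two functions return a default. *)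
Definition fl_up (R : realType) (beta p : nat) (x : R) : R :=
  xget 0 [set y | (float beta p y /\ x <= y) /\
                  forall z, float beta p z -> x <= z -> y <= z].

Definition fl_down (R : realType) (beta p : nat) (x : R) : R :=
  xget 0 [set y | (float beta p y /\ y <= x) /\
                  forall z, float beta p z -> z <= x -> z <= y].

Definition theta (R : realType) (beta p : nat) (x : R) : R :=
  (x - fl_down beta p x) / (fl_up beta p x - fl_down beta p x).

Inductive fop := Add | Sub | Mul | Div.

(* In a field of MathComp x / 0 = 0: a division by zero has exact result 0. *)
Definition apply_fop (R : realType) (o : fop) (a b : R) : R :=
  match o with
  | Add => a + b
  | Sub => a - b
  | Mul => a * b
  | Div => a / b
  end.

Inductive operand (R : realType) (k : nat) :=
  | Data of R
  | Computed of 'I_k.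

Record operation (R : realType) (k : nat) := Operation {
  op : fop;
  lhs : operand R k;
  rhs : operand R k }.

Definition program (R : realType) := forall k : nat, operation R k.

Definition operand_value (R : realType) (k : nat) (h : 'I_k -> R)
    (a : operand R k) : R :=
  match a with
  | Data x => x
  | Computed i => h i
  end.

(* Exact result of the k-th operation applied to the rounded operands, when the
   previously computed values are h. *)
Definition exact_result (R : realType) (prog : program R) (k : nat)
    (h : 'I_k -> R) : R :=
  apply_fop (op (prog k)) (operand_value h (lhs (prog k)))
                          (operand_value h (rhs (prog k))).

Definition cond_prob d (T : measurableType d) (R : realType)
    (P : probability T R) (A B : set T) : R :=
  fine (P (A `&` B)) / fine (P B).

Section stochastic_rounding.
Context d (T : measurableType d) (R : realType) (P : probability T R).
Variables (beta p : nat) (prog : program R).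

Definition history (c : nat -> {RV P >-> R}) (k : nat) (w : T) : 'I_k -> R :=
  fun i => c i w.

(* c k is the value computed by the k-th operation. The computed values are
   discrete, so conditioning on all previous roundings is elementary
   conditioning on the histories h of positive probability. *)
Definition SR_execution (c : nat -> {RV P >-> R}) : Prop :=
  forall (k : nat) (h : 'I_k -> R),
    let past := [set w | history c w = h] in
    let x := exact_result prog h in
    (0 < P past)%E ->
    ((float beta p x \/ x = 0) ->
       cond_prob P [set w | c k w = x] past = 1) /\
    (~ (float beta p x \/ x = 0) ->
       cond_prob P [set w | c k w = fl_up beta p x] past = theta beta p x /\
       cond_prob P [set w | c k w = fl_down beta p x] past
         = 1 - theta beta p x).

(* The solution of c k w = x * (1 + delta), where x is the exact result, and 0 when
   x = 0. *)
Definition rel_error (c : nat -> {RV P >-> R}) (k : nat) (w : T) : R :=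
  let x := exact_result prog (history c (k := k) w) in
  if x == 0 then 0 else (c k w - x) / x.

Definition psi (c : nat -> {RV P >-> R}) (K : {fset nat}) (w : T) : R :=
  \prod_(k <- enum_fset K) (1 + rel_error c k w).

End stochastic_rounding.

Definition gamma (R : realType) (m : nat) (v : R) : R := (1 + v) ^+ m - 1.

Definition fsymdiff (K K' : {fset nat}) : {fset nat} :=
  ((K `|` K') `\` (K `&` K'))%fset.

(* Main.v *)
Require Import Defs.
From mathcomp Require Import all_boot all_order all_algebra.
From mathcomp Require Import classical_sets measurable_realfun ring lra.

(* Conditionally on the values computed before step [k], the computed value [c k]
   takes at most two values, its relative error [delta k] is centered and
   [`|delta k| <= u <= 1]. Hence, for [a] in {0, 1, 2}, the conditional expectation
   of the nonnegative variable [(1 + delta k) ^+ a] is at least 1, and at most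
   [1 + u ^+ 2] if [a = 2] and 1 otherwise. Multiplying these bounds, from the last
   step back to the first, bounds the expectation of any product of such powers;
   [psi K * psi K'] is such a product, with exponent 2 exactly on the
   intersection of [K] and [K']. *)

Set Implicit Arguments.
Unset Strict Implicit.
Unset Printing Implicit Defensive.

Import Order.TTheory GRing.Theory Num.Theory.
Local Open Scope ring_scope.

(** * Neighbouring floats of a real number and the width of the gap between them *)

Section floats.
Context (R : realType) (beta p : nat).
Hypotheses (hbeta : (2 <= beta)%N) (hp : (1 <= p)%N).
Local Notation b := (beta%:R : R).
Local Notation u := (unit_roundoff R beta p).

Let b_gt1 : 1 < b. Proof. by rewrite ltr1n. Qed.
Let b_gt0 : 0 < b. Proof. exact: lt_trans b_gt1. Qed.
Let b_neq0 : b != 0. Proof. by rewrite gt_eqF. Qed.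

Lemma unit_roundoff_le1 : u <= 1.
Proof. by rewrite -(expr0z b) ler_eXz2l // subr_le0 lez_nat. Qed.

Lemma exists_exponent (x : R) : 0 < x -> exists e : int, b ^ (e - 1) <= x < b ^ e.
Proof.
move=> x0.
have small (y : R) : exists n : nat, y < b ^+ n.
  exists (Num.bound `|y|); apply: (le_lt_trans (ler_norm y)).
  apply: (lt_le_trans (archi_boundP (normr_ge0 y))).
  by rewrite -natrX ler_nat ltnW // ltn_expl.
(* The least exponent [e] with [x < b ^ e] is sought among the [i - M] with [i] natural; since
   [b ^ (- M) < x], the index [i = 0] fails and the minimal [i] has a predecessor. *)
have [M xM] := small x^-1; have [N xN] := small x.
have ex : exists i : nat, x < b ^ (i%:Z - M%:Z).
  exists (N + M)%N; rewrite PoszD addrK; exact: xN.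
case: (ex_minnP ex) => i xi imin; exists (i%:Z - M%:Z); rewrite xi andbT.
case: i xi imin => [|i] xi imin.
  move: xM; rewrite invf_plt ?posrE ?exprn_gt0 //; move: xi.
  by rewrite sub0r -exprz_inv -exprnP exprVn => /lt_trans xi /xi; rewrite ltxx.
rewrite leNgt; apply/negP => xi'.
suff : (i.+1 <= i)%N by rewrite ltnn.
by apply: imin; move: xi'; rewrite -addn1 PoszD addrAC addrK.
Qed.

Lemma floatN (x : R) : float beta p x -> float beta p (- x).
Proof.
move=> [s [m [e [m1 m2 ->]]]]; exists (~~ s), m, e; split=> //.
by rewrite signrN !mulNr.
Qed.

(** The last clause makes [lo] and [hi] consecutive floats, which identifies them with [fl_down] and
    [fl_up]; the bound on the width keeps the relative error within [u] whichever of them is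
    chosen. *)
Definition rounding_gap (x lo hi : R) :=
  [/\ float beta p lo, float beta p hi, lo < x < hi, hi - lo <= u * `|x|
    & forall z, float beta p z -> z <= lo \/ hi <= z].

Lemma rounding_gapN (x lo hi : R) :
  rounding_gap x lo hi -> rounding_gap (- x) (- hi) (- lo).
Proof.
move=> [flo fhi /andP[lox xhi] gap sep]; split; try exact: floatN.
- by rewrite !ltrN2 xhi.
- by rewrite opprK addrC normrN.
- move=> z /floatN /sep [zlo|zhi]; [right|left]; lra.
Qed.

(** Floats between [b ^ (e - 1)] and [b ^ e] are the multiples of [w = b ^ (e - p)], so truncating
    [x / w] yields both neighbours; their distance is [w = u * b ^ (e - 1) <= u * x]. *)
Lemma rounding_gap_pos (x : R) : 0 < x -> ~ float beta p x ->
  exists lo hi, rounding_gap x lo hi.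
Proof.
move=> x0 xF; have [e /andP[ex xe]] := exists_exponent x0.
pose w := b ^ (e - p%:Z); have w0 : 0 < w by rewrite exprz_gt0.
have wP (n : nat) (e' : int) : b ^+ n * b ^ e' = b ^ (n%:Z + e').
  by rewrite expfzDr.
have bp1 : b ^+ p.-1 * w = b ^ (e - 1).
  rewrite wP; congr (_ ^ _).
  by rewrite -[in RHS](subrK p%:Z e) -{2}(prednK hp) -addn1 PoszD; ring.
have bp : b ^+ p * w = b ^ e by rewrite wP addrC subrK.
pose t := x / w; have xt : x = t * w by rewrite divfK ?gt_eqF.
have t0 : 0 <= t by rewrite divr_ge0 // ltW.
pose m := Num.truncn t.
have /andP[mt tm] : m%:R <= t < m.+1%:R by exact: truncn_itv.
have m1 : (beta ^ p.-1 <= m)%N.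
  by rewrite truncn_ge_nat // natrX ler_pdivlMr // bp1.
have m2 : (m < beta ^ p)%N.
  by rewrite -(ltr_nat R); apply: (le_lt_trans mt); rewrite natrX ltr_pdivrMr // bp.
have hiE : float beta p (m.+1%:R * w).
  (* If [m.+1 = beta ^ p], the upper neighbour is [b ^ e], whose normal form has exponent [e + 1]
     and the smallest significand. *)
  move: m2; rewrite leq_eqVlt => /predU1P[mE|m2].
    exists false, (beta ^ p.-1)%N, (e + 1); split=> //.
      by rewrite ltn_exp2l // prednK.
    rewrite mul1r mE !natrX bp wP; congr (_ ^ _).
    by rewrite -[in p%:Z](prednK hp) -addn1 PoszD; ring.
  by exists false, m.+1, e; split; rewrite ?mul1r // ltnW.
exists (m%:R * w), (m.+1%:R * w); split=> //.
- by exists false, m, e; split; rewrite ?mul1r.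
- rewrite [x]xt !ltr_pM2r // tm andbT lt_neqAle mt andbT.
  apply/eqP => mtE; apply: xF; rewrite xt -mtE.
  by exists false, m, e; split; rewrite ?mul1r.
- rewrite -mulrBl -natrB // subSnn mul1r gtr0_norm //.
  suff -> : w = u * b ^ (e - 1) by rewrite ler_wpM2l // exprz_ge0 // ltW.
  by rewrite -expfzDr //; congr (_ ^ _); ring.
move=> z [s [n [e' [n1 n2 ->]]]].
have [->|sF] := eqVneq s true.
  left; rewrite mulN1r mulNr; apply: (@le_trans _ _ 0).
    by rewrite oppr_le0 mulr_ge0 // exprz_ge0 // ltW.
  by rewrite mulr_ge0 // ltW.
move: sF => /negbTE; rewrite eqb_id => ->; rewrite mul1r.
(* A larger exponent puts [z] above [b ^ e >= hi], a smaller one below [b ^ (e - 1) <= lo]; for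
   equal exponents the significands are compared. *)
have [ee'|ee'|<-] := ltgtP e e'.
- right; apply: (@le_trans _ _ (b ^+ p.-1 * b ^ (e' - p%:Z))); last first.
    by rewrite ler_pM2r ?exprz_gt0 // -natrX ler_nat.
  apply: (@le_trans _ _ (b ^ e)).
    by rewrite -bp ler_pM2r // -natrX ler_nat.
  rewrite wP ler_eXz2l //.
  have -> : p.-1%:Z + (e' - p%:Z) = e' - 1.
    by rewrite -{2}(prednK hp) -addn1 PoszD; ring.
  by rewrite lerBrDr lezD1.
- left; apply: (@le_trans _ _ (b ^+ p * b ^ (e' - p%:Z))).
    by rewrite ler_pM2r ?exprz_gt0 // -natrX ler_nat ltnW.
  apply: (@le_trans _ _ (b ^ (e - 1))).
    by rewrite wP addrC subrK ler_eXz2l // lerBrDr lezD1.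
  by rewrite -bp1 ler_pM2r // -natrX ler_nat.
- have [nm|mn] := leqP n m.
    by left; rewrite ler_pM2r // ler_nat.
  by right; rewrite ler_pM2r // ler_nat.
Qed.

Lemma rounding_gap_exists (x : R) : x != 0 -> ~ float beta p x ->
  exists lo hi, rounding_gap x lo hi.
Proof.
case: (ltgtP 0 x) => [x0 _|x0 _ xF|<-]; rewrite ?eqxx //; first exact: rounding_gap_pos.
have [||lo [hi H]] := @rounding_gap_pos (- x); first by rewrite oppr_gt0.
  by move=> /floatN; rewrite opprK.
by exists (- hi), (- lo); rewrite -[x]opprK; exact: rounding_gapN.
Qed.

Lemma fl_updown_gap (x lo hi : R) : rounding_gap x lo hi ->
  fl_up beta p x = hi /\ fl_down beta p x = lo.
Proof.
move=> [flo fhi /andP[lox xhi] _ sep]; split; apply: xget_unique.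
- by split=> [|z /sep []]; [split=> //; exact: ltW|lra|].
- move=> y [[fy xy] /(_ _ fhi (ltW xhi)) yhi]; apply: le_anti.
  by rewrite yhi; case: (sep _ fy) => //; lra.
- by split=> [|z /sep []]; [split=> //; exact: ltW| |lra].
- move=> y [[fy xy] /(_ _ flo (ltW lox)) loy]; apply: le_anti.
  by rewrite loy andbT; case: (sep _ fy) => //; lra.
Qed.

End floats.

(** * Auxiliary facts on inverses, two-point moments and finite products *)

Lemma measurable_inv (R : realType) : measurable_fun [set: R] (fun x : R => x^-1).
Proof.
(* Squaring makes the base of the real power nonnegative; at 0 both sides are 0. *)
have -> : (fun x : R => x^-1) = (fun x => x * (x ^+ 2) `^ (-1)).
  apply/funext => x; rewrite powR_inv1 ?sqr_ge0 // expr2.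
  have [->|x0] := eqVneq x 0; first by rewrite invr0 mul0r.
  by rewrite invfM mulrA divff // mul1r.
apply: measurable_funM => //; apply: measurableT_comp (measurable_powR _) _.
exact: exprn_measurable.
Qed.

(** On expansion the linear terms cancel since the mean is 0; beyond the constant 1 only the second
    moment can remain, when [a] and [b] both hold, and it lies between 0 and [v ^+ 2]. *)
Lemma moment_bounds (R : realFieldType) (v q d1 d2 : R) (a b : bool) :
  0 <= q <= 1 -> `|d1| <= v -> `|d2| <= v -> q * d1 + (1 - q) * d2 = 0 ->
  1 <= q * (1 + d1) ^+ (a + b) + (1 - q) * (1 + d2) ^+ (a + b)
    <= (1 + v ^+ 2) ^+ (a && b).
Proof.
move=> /andP[q0 q1] d1v d2v mean0.
have sq x : `|x| <= v -> x ^+ 2 <= v ^+ 2.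
  by move=> xv; rewrite -real_normK ?num_real // lerXn2r ?nnegrE // (le_trans _ xv).
have s1 := sq _ d1v; have s2 := sq _ d2v.
have [e1 e2] : 0 <= d1 ^+ 2 /\ 0 <= d2 ^+ 2 by rewrite !sqr_ge0.
have -> : q * (1 + d1) ^+ (a + b) + (1 - q) * (1 + d2) ^+ (a + b)
    = 1 + (a && b)%:R * (q * d1 ^+ 2 + (1 - q) * d2 ^+ 2).
  by case: a b => [] [] /=; rewrite ?addn1 ?addn0; lra.
have q1' : 0 <= 1 - q by lra.
case: (a && b) => /=; rewrite ?expr1 ?expr0; last by rewrite mul0r addr0 lexx.
have := (mulr_ge0 q0 e1, mulr_ge0 q1' e2, ler_wpM2l q0 s1, ler_wpM2l q1' s2).
by move=> [[[? ?] ?] ?]; apply/andP; split; lra.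
Qed.

(** Puts the factors in the order of time, as the induction over the steps requires. *)
Lemma big_fset_iota (R : Type) (idx : R) (op : Monoid.com_law idx)
    (K : {fset nat}) N (F : nat -> R) :
  {in K, forall i, (i < N)%N} ->
  \big[op/idx]_(i <- enum_fset K) F i = \big[op/idx]_(i <- iota 0 N | i \in K) F i.
Proof.
move=> KN; rewrite -[RHS]big_filter; apply: perm_big; apply: uniq_perm => //.
  by rewrite filter_uniq // iota_uniq.
move=> i; rewrite mem_filter mem_iota add0n /=.
by case: (boolP (i \in K)) => // /KN ->.
Qed.

(** * Splitting an integral along two events, up to a null set *)

Section two_pieces.
Local Open Scope classical_set_scope.
Context d (T : measurableType d) (R : realType) (P : probability T R).
Local Notation pr A := (fine (P A)).

Lemma fine_probabilityU (A B : set T) :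
  measurable A -> measurable B -> [disjoint A & B] ->
  pr (A `|` B) = pr A + pr B.
Proof.
move=> mA mB AB.
by rewrite measureU // ?fineD ?fin_num_measure //; exact/eqP.
Qed.

(** By additivity the part [N] of [A] outside both pieces has probability 0, so it affects neither
    integrability nor the integral. *)
Lemma Rintegral_two_pieces (A B1 B2 : set T) (f : T -> R) :
  measurable A -> measurable B1 -> measurable B2 -> [disjoint B1 & B2] ->
  B1 `|` B2 `<=` A -> pr A = pr B1 + pr B2 ->
  measurable_fun [set: T] f ->
  P.-integrable B1 (EFin \o f) -> P.-integrable B2 (EFin \o f) ->
  P.-integrable A (EFin \o f) /\
  (\int[P]_(w in A) f w = \int[P]_(w in B1) f w + \int[P]_(w in B2) f w)%R.
Proof.
move=> mA mB1 mB2 dis BA prA mf i1 i2.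
have mB : measurable (B1 `|` B2) by exact: measurableU.
pose N := A `\` (B1 `|` B2); have mN : measurable N by exact: measurableD.
have AN : A `\` N = B1 `|` B2 by rewrite setDD; exact: setIidr.
have PN0 : P N = 0.
  apply/eqP; rewrite -[P N]fineK ?fin_num_measure // eqe; apply/eqP.
  have : pr A = pr (B1 `|` B2) + pr N.
    rewrite -fine_probabilityU //; first by rewrite /N setDUK.
    by apply/eqP; rewrite /N setDIK.
  by rewrite fine_probabilityU // prA; lra.
have iB : P.-integrable (B1 `|` B2) (EFin \o f).
  move/integrableP: i1 => [m1 l1]; move/integrableP: i2 => [m2 l2].
  apply/integrableP; split; first by apply/measurable_funU.
  rewrite ge0_integral_setU //; first exact: lte_add_pinfty.
  by apply: measurableT_comp => //; apply/measurable_funU.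
have mfA : measurable_fun A (EFin \o f).
  by apply/measurable_EFinP; exact: measurable_funS mf.
have iA : P.-integrable A (EFin \o f).
  by apply/(negligible_integrable mN mA mfA PN0); rewrite AN.
split=> //.
by rewrite /Rintegral (negligible_integral mN mA iA PN0) AN -Rintegral_setU.
Qed.

End two_pieces.

(** * Histories of an execution and the law of one rounding *)

Section execution.
Local Open Scope classical_set_scope.
Context (R : realType) (beta p : nat).
Hypotheses (hbeta : (2 <= beta)%N) (hp : (1 <= p)%N).
Context (d : measure_display) (T : measurableType d) (P : probability T R).
Variables (prog : program R) (c : nat -> {RV P >-> R}).
Hypothesis hc : SR_execution beta p prog c.
Local Notation u := (unit_roundoff R beta p).
Local Notation pr A := (fine (P A)).
Local Notation delta := (rel_error prog c).

(** A history is taken on all of [nat], though only its first [k] values count, so that its type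
    stays the same as [k] grows. *)
Definition atom (k : nat) (h : nat -> R) : set T :=
  [set w | forall i, (i < k)%N -> c i w = h i].

Definition upd (h : nat -> R) (k : nat) (y : R) : nat -> R :=
  fun i => if i == k then y else h i.

Definition exact_at (h : nat -> R) (k : nat) : R :=
  exact_result prog (fun i : 'I_k => h i).

(** The error of step [k] as a deterministic function of the past and of the rounded value; this is
    its constant value on a successor atom. *)
Definition error_at (h : nat -> R) (k : nat) (y : R) : R :=
  let x := exact_at h k in if x == 0 then 0 else (y - x) / x.

Lemma atom0 h : atom 0 h = [set: T].
Proof. by apply/seteqP; split. Qed.

Lemma atomE k h : atom k h = [set w | history c (k := k) w = (fun i : 'I_k => h i)].
Proof.
apply/seteqP; split=> w /= H; first by apply/funext => i; exact: H.
by move=> i ik; move/(congr1 (@^~ (Ordinal ik))): H.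
Qed.

Lemma atomS k h y : atom k.+1 (upd h k y) = atom k h `&` [set w | c k w = y].
Proof.
apply/seteqP; split=> w /=.
  move=> H; split; last by rewrite H // /upd eqxx.
  by move=> i ik; rewrite H /upd ?(ltn_eqF ik) // ltnS ltnW.
move=> [H cky] i; rewrite ltnS leq_eqVlt /upd => /predU1P[->|ik].
  by rewrite eqxx.
by rewrite (ltn_eqF ik) H.
Qed.

Lemma measurable_level k y : measurable [set w | c k w = y].
Proof.
have -> : [set w | c k w = y] = [set: T] `&` c k @^-1` [set y] by rewrite setTI.
exact: measurable_funPT.
Qed.

Lemma measurable_atom k h : measurable (atom k h).
Proof.
elim: k => [|k IH]; first by rewrite atom0.
suff -> : atom k.+1 h = atom k h `&` [set w | c k w = h k].
  by apply: measurableI => //; exact: measurable_level.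
rewrite -atomS; congr atom; apply/funext => i; rewrite /upd.
by case: eqP => // ->.
Qed.

Lemma disjoint_atomS k h y1 y2 : y1 != y2 ->
  [disjoint atom k.+1 (upd h k y1) & atom k.+1 (upd h k y2)].
Proof.
move=> /eqP y12; rewrite !atomS; apply/disj_setPS => w [[_ /= e1] [_ /= e2]].
by apply: y12; rewrite -e1 -e2.
Qed.

Lemma delta_atomS k h y w : atom k.+1 (upd h k y) w -> delta k w = error_at h k y.
Proof.
rewrite atomS atomE => -[/= hw cky].
by rewrite /rel_error /error_at /exact_at hw cky.
Qed.

Lemma measurable_delta k : measurable_fun [set: T] (delta k).
Proof.
have mop (a : operand R k) :
    measurable_fun [set: T] (fun w => operand_value (history c (k := k) w) a).
  by case: a => [x|i] /=; [exact: measurable_cst|exact: measurable_funPT].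
have mdiv (f g : T -> R) : measurable_fun [set: T] f -> measurable_fun [set: T] g ->
    measurable_fun [set: T] (fun w => f w / g w).
  move=> mf mg; apply: measurable_funM => //.
  by apply: (measurableT_comp (@measurable_inv R)).
have mx : measurable_fun [set: T]
    (fun w => exact_result prog (history c (k := k) w)).
  rewrite /exact_result; case: (op (prog k)) => /=.
  - exact: measurable_funD.
  - exact: measurable_funB.
  - exact: measurable_funM.
  - exact: mdiv.
apply: measurable_fun_ifT.
- exact: measurable_fun_eqr.
- exact: measurable_cst.
- by apply: mdiv => //; apply: measurable_funB => //; exact: measurable_funPT.
Qed.

(* When no rounding is needed, [q = 1] and [y2] is an arbitrary value of
   probability 0 with a small error. *)
Lemma rounding_step k h : (0 < P (atom k h))%E ->
  exists y1 y2 q : R, let d1 := error_at h k y1 in let d2 := error_at h k y2 in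
  [/\ y1 != y2, 0 <= q <= 1, `|d1| <= u /\ `|d2| <= u, q * d1 + (1 - q) * d2 = 0
    & pr (atom k.+1 (upd h k y1)) = q * pr (atom k h) /\
      pr (atom k.+1 (upd h k y2)) = (1 - q) * pr (atom k h)].
Proof.
move=> Ppos; have mat := measurable_atom.
have prpos : 0 < pr (atom k h).
  by rewrite fine_gt0 // Ppos ltey_eq fin_num_measure.
have prS y : pr (atom k.+1 (upd h k y)) =
    cond_prob P [set w | c k w = y] (atom k h) * pr (atom k h).
  by rewrite /cond_prob divfK ?gt_eqF // setIC atomS.
have u0 : 0 < u by rewrite exprz_gt0 // ltr0n ltnW.
have := hc (h := fun i : 'I_k => h i); rewrite -atomE -/(exact_at h k).
rewrite /error_at; set x := exact_at h k => /(_ Ppos) {Ppos} [exact_case round_case].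
have [xF|xF] := pselect (float beta p x \/ x = 0).
  (* The value [x * (1 + u)] differs from [x] and has error exactly [u]; for [x = 0] every value has
     error 0, so any nonzero one serves. *)
  pose y2 := if x == 0 then 1 else x * (1 + u).
  have y12 : x != y2.
    rewrite /y2; have [->|x0] := eqVneq x 0; first by rewrite eq_sym oner_eq0.
    by rewrite eq_sym -subr_eq0 mulrDr mulr1 addrC addKr mulf_neq0 // gt_eqF.
  exists x, y2, 1; rewrite !subrr !mul0r if_same mulr0 addr0 normr0 /y2.
  have pr1 : pr (atom k.+1 (upd h k x)) = pr (atom k h).
    by rewrite prS exact_case // mul1r.
  split=> //; rewrite ?ler01 ?lexx ?(ltW u0) //.
  - split=> //; have [_|x0] := eqVneq x 0; first by rewrite normr0 ltW.
    by rewrite mulrDr mulr1 addrAC subrr add0r mulrC mulKf // ger0_norm // ltW.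
  (* The two successors are disjoint inside [atom k h], and the first already carries its whole
     probability. *)
  - rewrite mul1r; split=> //; apply/eqP; rewrite eq_le fine_ge0 // andbT.
    rewrite -(lerD2l (pr (atom k.+1 (upd h k x)))) addr0 {2}pr1.
    rewrite -fine_probabilityU //; last exact: disjoint_atomS.
    rewrite fine_le ?fin_num_measure //; first exact: measurableU.
    apply: le_measure; rewrite ?inE //; first exact: measurableU.
    by rewrite !atomS => w [] [].
have x0 : x != 0 by apply/eqP => x0; apply: xF; right.
have [|lo [hi gap]] := rounding_gap_exists hbeta hp x0.
  by move=> xF'; apply: xF; left.
have [upE downE] := fl_updown_gap gap.
case: gap => _ _ /andP[lox xhi] width _.
have [Pup Pdown] := round_case xF.
have wpos : 0 < hi - lo by lra.
have thetaE : theta beta p x = (x - lo) / (hi - lo) by rewrite /theta upE downE.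
have err y : `|y - x| <= hi - lo -> `|(y - x) / x| <= u.
  move=> yx; rewrite normrM normfV ler_pdivrMr ?normr_gt0 //.
  exact: le_trans width.
exists hi, lo, (theta beta p x); rewrite (negbTE x0); split.
- by rewrite gt_eqF //; lra.
- by rewrite thetaE divr_ge0 ?ler_pdivrMr ?mul1r //=; lra.
- by split; apply: err; rewrite ler_norml; lra.
(* The weight [theta] on [hi] is the one that makes the mean of the rounded value equal to [x]. *)
- rewrite thetaE; field; rewrite x0 /=; lra.
- by rewrite !prS -upE -downE Pup Pdown.
Qed.

(** With [A] and [B] the memberships in [K] and [K'], this is the part of [psi K * psi K'] due to
    the [n] steps from [k] on. *)
Definition err_prod (A B : pred nat) (k n : nat) (w : T) : R :=
  \prod_(i <- iota k n) (1 + delta i w) ^+ (A i + B i).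

Lemma measurable_err_prod A B k n : measurable_fun [set: T] (err_prod A B k n).
Proof.
apply: measurable_prod => i _; apply: measurable_funX.
by apply: measurable_funD => //; exact: measurable_delta.
Qed.

(** These are bounds on a conditional expectation, multiplied by the probability of the atom so that
    null atoms are covered too. *)
Lemma err_prod_atom_bounds (A B : pred nat) n k h :
  P.-integrable (atom k h) (EFin \o err_prod A B k n) /\
  pr (atom k h) <= (\int[P]_(w in atom k h) err_prod A B k n w)%R
    <= pr (atom k h) * \prod_(i <- iota k n) (1 + u ^+ 2) ^+ (A i && B i).
Proof.
have mat := measurable_atom; have mprod := measurable_err_prod.
(* Backward in time: each atom splits, up to a null set, into its two
   successors, on each of which the error of step [k] is constant. *)
elim: n k h => [|n IH] k h.
  have -> : err_prod A B k 0 = cst 1 by apply/funext => w; rewrite /err_prod big_nil.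
  split; first by apply: finite_measure_integrable_cst.
  by rewrite big_nil Rintegral_cst // mul1r mulr1 lexx.
have [P0|Pneq0] := eqVneq (P (atom k h)) 0.
  have mf : measurable_fun (atom k h) (EFin \o err_prod A B k n.+1).
    by apply/measurable_EFinP; exact: measurable_funS (mprod _ _ _ _).
  split; first exact: null_set_integrable.
  by rewrite /Rintegral (null_set_integral (mat _ _) mf P0) P0 /= mul0r lexx.
have Ppos : (0 < P (atom k h))%E by rewrite lt0e Pneq0 measure_ge0.
have [y1 [y2 [q [y12 q01 [D1 D2] mean0 [pr1 pr2]]]]] := rounding_step Ppos.
set d1 := error_at h k y1 in D1 mean0; set d2 := error_at h k y2 in D2 mean0.
have child y : P.-integrable (atom k.+1 (upd h k y)) (EFin \o err_prod A B k n.+1) /\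
    (\int[P]_(w in atom k.+1 (upd h k y)) err_prod A B k n.+1 w)%R =
    (1 + error_at h k y) ^+ (A k + B k) *
      (\int[P]_(w in atom k.+1 (upd h k y)) err_prod A B k.+1 n w)%R.
  have [ig _] := IH k.+1 (upd h k y).
  have E w : w \in atom k.+1 (upd h k y) -> err_prod A B k n.+1 w =
      (1 + error_at h k y) ^+ (A k + B k) * err_prod A B k.+1 n w.
    by rewrite inE => /delta_atomS <-; rewrite /err_prod big_cons.
  split; last by rewrite -RintegralZl //; exact: eq_Rintegral.
  apply: eq_integrable (integrableZl _ _ ig) => //.
  by move=> w wa /=; rewrite E // EFinM.
have [i1 e1] := child y1; have [i2 e2] := child y2.
have [||iA ->] := @Rintegral_two_pieces _ _ _ P (atom k h) _ _ _ (mat _ _)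
  (mat _ _) (mat _ _) (disjoint_atomS _ _ y12) _ _ (mprod A B k n.+1) i1 i2.
- by rewrite !atomS => w [] [].
- by rewrite pr1 pr2; ring.
split=> //; rewrite e1 e2 -/d1 -/d2.
have [_ /andP[l1 r1]] := IH k.+1 (upd h k y1).
have [_ /andP[l2 r2]] := IH k.+1 (upd h k y2).
rewrite big_cons.
have /andP[lo hi] := moment_bounds (A k) (B k) q01 D1 D2 mean0.
(* Since [u <= 1], the factors of step [k] are nonnegative and may multiply the inductive bounds. *)
have u1 := unit_roundoff_le1 R hbeta hp.
have nn d' : `|d'| <= u -> 0 <= (1 + d') ^+ (A k + B k).
  by move=> /ler_normlP [d'u _]; rewrite exprn_ge0 //; lra.
have n1 := nn _ D1; have n2 := nn _ D2; have pr0 : 0 <= pr (atom k h) by exact: fine_ge0.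
set F1 := _ ^+ _ in lo hi n1 *; set F2 := (1 + d2) ^+ _ in lo hi n2 *.
set C := \prod_(i <- _) _ in r1 r2 *; set G := _ ^+ _ in hi *.
have C0 : 0 <= C by rewrite prodr_ge0 // => i _; rewrite exprn_ge0 // addr_ge0 ?sqr_ge0.
apply/andP; split.
  apply: (@le_trans _ _ (F1 * (q * pr (atom k h)) + F2 * ((1 - q) * pr (atom k h)))).
    by have := ler_wpM2r pr0 lo; lra.
  by rewrite -pr1 -pr2 lerD // ler_wpM2l.
apply: (@le_trans _ _
  (F1 * (q * pr (atom k h) * C) + F2 * ((1 - q) * pr (atom k h) * C))).
  by rewrite -pr1 -pr2 lerD // ler_wpM2l.
by have := ler_wpM2r (mulr_ge0 pr0 C0) hi; lra.
Qed.

(** * Expectation and covariance of the products [psi] *)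

Lemma expectation_psi_mul_bounds (K K' : {fset nat}) :
  P.-integrable [set: T] (EFin \o (psi prog c K * psi prog c K')) /\
  (1%:E <= 'E_P[psi prog c K * psi prog c K']
      <= ((1 + u ^+ 2) ^+ #|` (K `&` K')%fset|)%:E)%E.
Proof.
(* A common horizon beyond all indices, so that both products run over the same steps. *)
pose N := (\max_(i <- enum_fset (K `|` K')%fset) i).+1.
have KN (i : nat) : i \in (K `|` K')%fset -> (i < N)%N.
  by move=> iK; rewrite /N ltnS; apply: (leq_bigmax_seq (r := enum_fset _)).
clearbody N.
have lift (L : {fset nat}) w : {in L, forall i, (i < N)%N} -> psi prog c L w =
    \prod_(i <- iota 0 N) (1 + delta i w) ^+ (i \in L).
  move=> LN; rewrite /psi (big_fset_iota _ _ LN) big_mkcond; apply: eq_bigr => j _.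
  by case: (j \in L).
have E : psi prog c K * psi prog c K' = err_prod [in K] [in K'] 0 N.
  apply/funext => w; rewrite -[LHS]/(psi prog c K w * psi prog c K' w) !lift.
  - by rewrite /err_prod -big_split; apply: eq_bigr => i _; rewrite exprD.
  - by move=> i iK; apply: KN; rewrite in_fsetU iK orbT.
  - by move=> i iK; apply: KN; rewrite in_fsetU iK.
have C : \prod_(i <- iota 0 N) (1 + u ^+ 2) ^+ ((i \in K) && (i \in K')) =
    (1 + u ^+ 2) ^+ #|` (K `&` K')%fset|.
  rewrite prodrXr; congr (_ ^+ _); rewrite -big_mkcond /= sum1_count -size_filter.
  apply/perm_size/uniq_perm; rewrite ?filter_uniq ?iota_uniq ?fset_uniq //.
  move=> i; rewrite mem_filter mem_iota add0n in_fsetI /=.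
  by case: (boolP (i \in K)) => //= iK; rewrite KN ?andbT // in_fsetU iK.
(* At time 0 the atom is the whole space, whatever the history; [fun=> 0] is a placeholder. *)
have [] := err_prod_atom_bounds [in K] [in K'] N 0 (fun=> 0).
rewrite -E atom0 probability_setT /= mul1r C => i /andP[l r]; split=> //.
rewrite unlock -[X in (_ <= X <= _)%E]fineK ?integrable_fin_num // !lee_fin.
by rewrite l.
Qed.

Lemma psi_mul_fset0 K : psi prog c K * psi prog c fset0 = psi prog c K.
Proof.
apply/funext => w; rewrite -[LHS]/(psi prog c K w * psi prog c fset0 w).
by rewrite {2}/psi big_seq_fset0 mulr1.
Qed.

(** Against the empty set no exponent is 2, so the lower and upper bounds are both 1. *)
Lemma expectation_psi K : ('E_P[psi prog c K] = 1)%E.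
Proof.
have [_] := expectation_psi_mul_bounds K fset0.
by rewrite psi_mul_fset0 fsetI0 cardfs0 expr0 => /le_anti.
Qed.

Lemma psi_Lfun1 K : psi prog c K \in Lfun P 1.
Proof.
apply/Lfun1_integrable.
by have [] := expectation_psi_mul_bounds K fset0; rewrite psi_mul_fset0.
Qed.

(** As both expectations are 1, the covariance is the expectation of the product minus 1. *)
Lemma covariance_psi_bounds (K K' : {fset nat}) :
  (0 <= covariance P (psi prog c K) (psi prog c K')
     <= (gamma #|` (K `&` K')%fset| (u ^+ 2))%:E)%E.
Proof.
have [i /andP[l r]] := expectation_psi_mul_bounds K K'.
rewrite covarianceE ?psi_Lfun1 //; last exact/Lfun1_integrable.
rewrite !expectation_psi mule1 sube_ge0 // l /=.
by rewrite /gamma EFinB leeD2r.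
Qed.

End execution.

Theorem lemma3p1 (R : realType) (beta p : nat)
    (hbeta : (2 <= beta)%N) (hp : (1 <= p)%N)
    (d : measure_display) (T : measurableType d) (P : probability T R)
    (prog : program R) (c : nat -> {RV P >-> R})
    (hc : SR_execution beta p prog c)
    (K : {fset nat}) (n : nat) (hn : #|` K| = n) :
  let u : R := unit_roundoff R beta p in
  [/\ ('E_P[psi prog c K] = 1)%E,
      forall (K' : {fset nat}) (m : nat),
        #|` (K `&` K')%fset| = m ->
        (forall j k : nat, j \in fsymdiff K K' -> k \in (K `&` K')%fset ->
           (j < k)%N) ->
        (0 <= covariance P (psi prog c K) (psi prog c K')
           <= (gamma m (u ^+ 2))%:E)%E
    & ('V_P[psi prog c K] <= (gamma n (u ^+ 2))%:E)%E].
Proof.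
move=> u; split.
- exact: (expectation_psi hbeta hp hc K).
- by move=> K' m <- _; exact: covariance_psi_bounds.
(* The variance is the covariance of [psi K] with itself. *)
- have /andP[_] := covariance_psi_bounds hbeta hp hc K K.
  by rewrite fsetIid hn.
Qed.
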